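(* Let $\Gamma$ be a countable set, $\Lambda\subset\Gamma$ finite, $A\in\mathcal{A}_\Lambda^+$, $X\subset\Lambda$, and $\epsilon>0$. If $\|[A,B]\|\le\epsilon\|B\|$ for all $B\in\mathcal{A}_{X^c}$, where $X^c=\Lambda\setminus X$, then there exists $A'\in\mathcal{A}_X^+$ such that $\|A-A'\|\le\epsilon$.
   Context: For finite $\Lambda\subset\Gamma$, $\mathcal{A}_\Lambda$ is the CAR algebra generated by $a_x,a_x^*$, $x\in\Lambda$, with $\{a_x,a_y\}=\{a_x^*,a_y^*\}=0$, $\{a_x,a_y^*\}=\delta_{x,y}\mathbb{1}$, where $\{A,B\}=AB+BA$; for $X\subset\Lambda$, $\mathcal{A}_X\subset\mathcal{A}_\Lambda$ is the subalgebra generated by $a_x,a_x^*$, $x\in X$. $\mathcal{A}_X^+$ is the set of even elements of $\mathcal{A}_X$: those $A\in\mathcal{A}_X$ with $(-1)^{N_X}A(-1)^{N_X}=A$, $N_X=\sum_{x\in X}a_x^*a_x$. $[A,B]=AB-BA$, and $\|\cdot\|$ is the $C^*$-norm. *)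

(* Defs.v *)
From HB Require Import structures.
From mathcomp Require Import all_boot all_order all_algebra finmap complex.
From mathcomp Require Import boolp classical_sets reals topology normedtype.
From mathcomp Require Import sequences trigo.

Set Implicit Arguments.
Unset Strict Implicit.
Unset Printing Implicit Defensive.
Import Order.TTheory GRing.Theory Num.Theory numFieldNormedType.Exports.

Local Open Scope classical_set_scope.
Local Open Scope ring_scope.
Local Open Scope complex_scope.

(* Unital complex C*-algebras.  The norm is a field of the mixin, and not the
   norm of a normed module over R[i], because Hierarchy Builder rejects a
   structure that joins rings and normed modules but lies outside of
   numDomainType.  Algebras are nontrivial (1 != 0), and [z^*] is the complex
   conjugate of the scalar z. *)
HB.mixin Record isCStarAlgebra (R : realType) A of GRing.Algebra R[i] A := {
  star : A -> A;
  starK : involutive star;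
  starD : forall a b : A, star (a + b) = star a + star b;
  starZ : forall (z : R[i]) (a : A), star (z *: a) = z^* *: star a;
  starM : forall a b : A, star (a * b) = star b * star a;
  cnorm : A -> R;
  cnorm0_eq0 : forall a : A, cnorm a = 0 -> a = 0;
  cnormD_le : forall a b : A, cnorm (a + b) <= cnorm a + cnorm b;
  cnormZ : forall (z : R[i]) (a : A), cnorm (z *: a) = Normc.normc z * cnorm a;
  cnormM_le : forall a b : A, cnorm (a * b) <= cnorm a * cnorm b;
  cnorm_cstar : forall a : A, cnorm (star a * a) = cnorm a ^+ 2;
  cnorm_complete : forall u : nat -> A,
    (forall e : R, 0 < e ->
       exists N, forall m n, (N <= m)%N -> (N <= n)%N -> cnorm (u m - u n) < e) ->
    exists l : A, (fun n => cnorm (u n - l)) @ \oo --> (0 : R)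
}.

#[short(type="cstarAlgType")]
HB.structure Definition CStarAlgebra (R : realType) :=
  {A of isCStarAlgebra R A & GRing.Algebra R[i] A}.

Section Car.
Context {R : realType} {A : cstarAlgType R}.

Definition commutator (a b : A) : A := a * b - b * a.
Definition anticommutator (a b : A) : A := a * b + b * a.

Definition cnorm_limit (u : nat -> A) : A :=
  xget 0 [set l : A | (fun n => cnorm (u n - l)) @ \oo --> (0 : R)].

Definition expA (a : A) : A :=
  cnorm_limit (fun n => \sum_(0 <= k < n) (k`!%:R : R[i])^-1 *: a ^+ k).

Definition subalg_gen (G : set A) : set A :=
  smallest [set B : set A | GRing.subalg_closed (mem B)] G.

Context {Gamma : countType} {Lambda : {fset Gamma}} (a : Lambda -> A).

(* Subalgebras are unital, so that [local_alg fset0] consists of the scalars. *)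
Definition local_alg (X : {fset Gamma}) : set A :=
  subalg_gen [set b | exists2 x : Lambda, val x \in X & b = a x \/ b = star (a x)].

(* These conditions determine A up to isometric *-isomorphism. *)
Record is_CAR_algebra : Prop := IsCARAlgebra {
  car_aa : forall x y, anticommutator (a x) (a y) = 0;
  car_cc : forall x y, anticommutator (star (a x)) (star (a y)) = 0;
  car_ac : forall x y, anticommutator (a x) (star (a y)) = (x == y)%:R;
  car_gen : local_alg Lambda = setT
}.

Definition number_op (X : {fset Gamma}) : A :=
  \sum_(x : Lambda | val x \in X) star (a x) * a x.

(* (-1)^N is the functional calculus exp (i pi N). *)
Definition parity_op (X : {fset Gamma}) : A :=
  expA ((0 +i* pi) *: number_op X).

Definition even_local_alg (X : {fset Gamma}) : set A :=
  [set b | local_alg X b /\ parity_op X * b * parity_op X = b].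

End Car.

(* Main.v *)
(* Let c range over the Majorana operators a_x + a_x*, i(a_x - a_x* ) of the
   sites outside X.  They are pairwise anticommuting self-adjoint involutions.
   Replacing B by (B + c B c) / 2 for each c in turn removes c from an even B,
   so A becomes an even element of the algebra of X.  The outcome is an average
   of elements V A V* with V a unitary of the algebra of X^c, each of which is
   at distance ||[A, V]|| <= eps from A.

   The parity exp(i pi N_X) is identified with the product of the factors
   1 - 2 a_x* a_x: as N_X is a sum of commuting idempotents,
   N_X^m = sum_k k^m P_k for coefficients P_k independent of m, so the
   exponential series converges to sum_k (-1)^k P_k. *)
Require Import Defs.
From HB Require Import structures.
From mathcomp Require Import all_boot all_order all_algebra finmap complex.
From mathcomp Require Import boolp classical_sets reals topology normedtype.
From mathcomp Require Import sequences trigo.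

Set Implicit Arguments.
Unset Strict Implicit.
Unset Printing Implicit Defensive.

Import Order.TTheory GRing.Theory Num.Theory numFieldNormedType.Exports.
Local Open Scope classical_set_scope.
Local Open Scope ring_scope.

(** * Generated subalgebras *)

Lemma subalg_gen_min (R : realType) (A : cstarAlgType R) (G B : set A) :
  G `<=` B -> B 1 ->
  (forall (z : R[i]) x y, B x -> B y -> B (z *: x + y)) ->
  (forall x y, B x -> B y -> B (x * y)) -> subalg_gen G `<=` B.
Proof.
move=> GB B1 BL BM x; apply; split=> //; split.
- by apply/mem_set.
- by move=> z u v /set_mem Bu /set_mem Bv; apply/mem_set/BL.
- by move=> u v /set_mem Bu /set_mem Bv; apply/mem_set/BM.
Qed.

Lemma subalg_gen_in (R : realType) (A : cstarAlgType R) (G : set A) :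
  G `<=` subalg_gen G.
Proof. by move=> x Gx B [_ GB]; apply: GB. Qed.

Lemma subalg_gen1 (R : realType) (A : cstarAlgType R) (G : set A) :
  subalg_gen G 1.
Proof. by move=> B [[/set_mem B1 _ _] _]. Qed.

Lemma subalg_genL (R : realType) (A : cstarAlgType R) (G : set A)
    (z : R[i]) (x y : A) :
  subalg_gen G x -> subalg_gen G y -> subalg_gen G (z *: x + y).
Proof.
move=> Gx Gy B BG; have [[_ BL _] _] := BG.
by apply/set_mem/BL; apply/mem_set; [apply: Gx|apply: Gy].
Qed.

Lemma subalg_genM (R : realType) (A : cstarAlgType R) (G : set A) (x y : A) :
  subalg_gen G x -> subalg_gen G y -> subalg_gen G (x * y).
Proof.
move=> Gx Gy B BG; have [[_ _ BM] _] := BG.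
by apply/set_mem/BM; apply/mem_set; [apply: Gx|apply: Gy].
Qed.

Lemma subalg_genD (R : realType) (A : cstarAlgType R) (G : set A) (x y : A) :
  subalg_gen G x -> subalg_gen G y -> subalg_gen G (x + y).
Proof. by move=> Gx Gy; rewrite -[x]scale1r; apply: subalg_genL. Qed.

Lemma subalg_gen0 (R : realType) (A : cstarAlgType R) (G : set A) :
  subalg_gen G 0.
Proof.
rewrite -(addNr (1 : A)) -scaleN1r.
by apply: subalg_genL; apply: subalg_gen1.
Qed.

Lemma subalg_genZ (R : realType) (A : cstarAlgType R) (G : set A) (z : R[i])
    (x : A) : subalg_gen G x -> subalg_gen G (z *: x).
Proof.
by move=> Gx; rewrite -[_ *: _]addr0; apply: subalg_genL => //; apply: subalg_gen0.
Qed.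

Lemma subalg_gen_sub (R : realType) (A : cstarAlgType R) (G H : set A) :
  G `<=` subalg_gen H -> subalg_gen G `<=` subalg_gen H.
Proof.
move=> GH; apply: subalg_gen_min => //.
- exact: subalg_gen1.
- by move=> z x y; apply: subalg_genL.
- by move=> x y; apply: subalg_genM.
Qed.

(** * Conjugation by an involution *)

Lemma involution_conjM (R : pzRingType) (u x y : R) :
  u * u = 1 -> u * (x * y) * u = u * x * u * (u * y * u).
Proof. by move=> uu; rewrite !mulrA -(mulrA (u * x) u u) uu mulr1. Qed.

Lemma conj_linear (R : realType) (A : cstarAlgType R) (u x y : A) (z : R[i]) :
  u * (z *: x + y) * u = z *: (u * x * u) + u * y * u.
Proof. by rewrite mulrDr mulrDl -scalerAr -scalerAl. Qed.

(** Conjugation by an involution is a unital algebra homomorphism, hence determined by its values on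
    generators. This is what later trades the parity of [Lambda] for the parity of [X]. *)
Lemma eq_conj_gen (R : realType) (A : cstarAlgType R) (G : set A) (u v : A) :
  u * u = 1 -> v * v = 1 -> (forall g, G g -> u * g * u = v * g * v) ->
  forall x, subalg_gen G x -> u * x * u = v * x * v.
Proof.
move=> uu vv uvG; apply: subalg_gen_min => //.
- by rewrite !mulr1 uu vv.
- by move=> z x y ux uy; rewrite !conj_linear ux uy.
- by move=> x y ux uy; rewrite !involution_conjM // ux uy.
Qed.

Lemma conj_gen_closed (R : realType) (A : cstarAlgType R) (G : set A) (u : A) :
  u * u = 1 -> (forall g, G g -> u * g * u = - g) ->
  forall x, subalg_gen G x -> subalg_gen G (u * x * u).
Proof.
move=> uu uG; apply: subalg_gen_min => //.
- by move=> g Gg; rewrite uG // -[- g]scaleN1r; apply: subalg_genZ; exact: subalg_gen_in.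
- by rewrite mulr1 uu; apply: subalg_gen1.
- by move=> z x y ux uy; rewrite conj_linear; apply: subalg_genL.
- by move=> x y ux uy; rewrite involution_conjM //; apply: subalg_genM.
Qed.

Lemma scale_halfD (R : realType) (A : cstarAlgType R) (x : A) :
  (2^-1 : R[i]) *: (x + x) = x.
Proof.
by rewrite -[x + x]mulr2n -(scaler_nat 2 x) scalerA mulVf ?pnatr_eq0 // scale1r.
Qed.

(** The elements [p + q * u] are closed under products: from [u * p' = (u * p' * u) * u], a factor
    [u] moves to the right at the cost of a conjugation, which preserves the algebra of [G], and
    [u * u = 1] absorbs a second [u]. *)
Lemma gen_adjoin (R : realType) (A : cstarAlgType R) (G : set A) (u : A) :
  u * u = 1 -> (forall g, G g -> u * g * u = - g) ->
  forall x, subalg_gen (u |` G) x ->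
  exists p q, [/\ subalg_gen G p, subalg_gen G q & x = p + q * u].
Proof.
move=> uu uG; apply: subalg_gen_min.
- move=> g [->|Gg].
    exists 0, 1; split; rewrite ?mul1r ?add0r //; first exact: subalg_gen0.
    exact: subalg_gen1.
  exists g, 0; split; rewrite ?mul0r ?addr0 //; first exact: subalg_gen_in.
  exact: subalg_gen0.
- exists 1, 0; split; rewrite ?mul0r ?addr0 //; first exact: subalg_gen1.
  exact: subalg_gen0.
- move=> z _ _ [p [q [Gp Gq ->]]] [p' [q' [Gp' Gq' ->]]].
  exists (z *: p + p'), (z *: q + q'); split; try exact: subalg_genL.
  by rewrite scalerDr mulrDl -scalerAl !addrA (addrAC (z *: p)).
- move=> _ _ [p [q [Gp Gq ->]]] [p' [q' [Gp' Gq' ->]]].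
  exists (p * p' + q * (u * q' * u)), (p * q' + q * (u * p' * u)).
  have ucl := conj_gen_closed uu uG.
  split; try by apply: subalg_genD; apply: subalg_genM => //; apply: ucl.
  rewrite [(_ + q * (u * p' * u)) * u]mulrDl.
  have -> : q * (u * p' * u) * u = q * u * p'.
    by rewrite !mulrA -(mulrA (q * u * p')) uu mulr1.
  rewrite mulrDl !mulrDr !mulrA -!addrA; congr (_ + _).
  by rewrite [RHS]addrC -addrA.
Qed.

(* Write x = p + q u with p, q in the algebra of G.  Conjugation by w acts on
   that algebra as conjugation by u but flips u, so evenness of x cancels the
   u-part of the average. *)
Lemma average_gen (R : realType) (A : cstarAlgType R) (G : set A) (u w : A) :
  u * u = 1 -> w * w = 1 -> w * u * w = - u ->
  (forall g, G g -> u * g * u = - g) -> (forall g, G g -> w * g * w = - g) ->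
  forall x, subalg_gen (u |` G) x -> w * x * w = x ->
  subalg_gen G ((2^-1 : R[i]) *: (x + u * x * u)) /\
  w * ((2^-1 : R[i]) *: (x + u * x * u)) * w =
    (2^-1 : R[i]) *: (x + u * x * u).
Proof.
move=> uu ww wu uG wG x Gx wx; split; last first.
  have wE : w * (u * x * u) * w = u * x * u.
    by rewrite involution_conjM // involution_conjM // wx wu mulNr mulrN mulNr opprK.
  have wS : w * (x + u * x * u) * w = x + u * x * u.
    by rewrite mulrDr mulrDl wx wE.
  by rewrite -[in LHS]scalerAr -[in LHS]scalerAl wS.
have [p [q [Gp Gq xE]]] := gen_adjoin uu uG Gx.
have uw : forall y, subalg_gen G y -> u * y * u = w * y * w.
  by apply: eq_conj_gen => // g Gg; rewrite uG // wG.
suff -> : x + u * x * u = u * p * u + u * p * u.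
  by rewrite scale_halfD; apply: conj_gen_closed.
have wxE : x = u * p * u - u * q.
  by rewrite -wx xE mulrDr mulrDl involution_conjM // wu mulrN -!uw // -!mulrA uu mulr1.
have uxE : u * x * u = u * p * u + u * q.
  by rewrite xE mulrDr mulrDl -!mulrA uu mulr1.
by rewrite uxE {1}wxE addrACA addNr addr0.
Qed.

(** * Elementary properties of the norm *)

Lemma cnorm_zero (R : realType) (A : cstarAlgType R) : cnorm (0 : A) = 0.
Proof. by rewrite -(scale0r (0 : A)) cnormZ Normc.normc0 mul0r. Qed.

Lemma cnorm_opp (R : realType) (A : cstarAlgType R) (x : A) :
  cnorm (- x) = cnorm x.
Proof. by rewrite -scaleN1r cnormZ normcN Normc.normc1 mul1r. Qed.

Lemma cnorm_ge0 (R : realType) (A : cstarAlgType R) (x : A) : 0 <= cnorm x.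
Proof.
have := cnormD_le x (- x).
by rewrite subrr cnorm_zero cnorm_opp -mulr2n pmulrn_lge0.
Qed.

Lemma cnorm_half (R : realType) (A : cstarAlgType R) (x : A) :
  cnorm ((2^-1 : R[i]) *: x) = 2^-1 * cnorm x.
Proof. by rewrite cnormZ Normc.normcV (normcMn 1) Normc.normc1. Qed.

Lemma star1 (R : realType) (A : cstarAlgType R) : star (1 : A) = 1.
Proof. by rewrite -[LHS]mul1r -[X in X * _](starK (1 : A)) -starM mul1r starK. Qed.

Lemma cnorm_isometry (R : realType) (A : cstarAlgType R) (x : A) :
  star x * x = 1 -> cnorm x = 1.
Proof.
(* The C*-identity makes [cnorm 1] equal to its own square, and it is nonzero because [1 != 0]. *)
have n1 : cnorm (1 : A) = 1.
  have := cnorm_cstar (1 : A); rewrite star1 mulr1 expr2 => /eqP.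
  rewrite -[X in X == _]mulr1 => /eqP/mulfI n1I; apply/esym/n1I.
  by apply/eqP => /cnorm0_eq0/eqP; rewrite oner_eq0.
move=> xx; have := cnorm_cstar x; rewrite xx n1 => /esym/eqP.
rewrite -[X in _ == X](expr1n _ 2) eqrXn2 ?cnorm_ge0 ?ler01 // => /eqP.
exact.
Qed.

(** * Averaging out a list of anticommuting involutions *)

(** Induction on [s], one involution being removed at a time. The distance bound is assumed for all
    conjugates of [x] by unitaries [v] of the algebra of [K], so that it survives the averaging:
    conjugating the average of [x] and [c x c] by [v] gives the mean of the conjugates of [x] by the
    unitaries [v] and [v c]. Here [w] stands for the parity and [J] for the generators that are
    kept. *)
Lemma average_out (R : realType) (A : cstarAlgType R) (I : eqType)
    (c : I -> A) (w x0 : A) (eps : R) (K J : set A) :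
  w * w = 1 -> (forall i, star (c i) = c i) -> (forall i, c i * c i = 1) ->
  (forall i j, i != j -> c i * c j * c i = - c j) ->
  (forall i, w * c i * w = - c i) ->
  (forall g, J g -> w * g * w = - g) ->
  forall s : seq I, uniq s -> (forall i, i \in s -> subalg_gen K (c i)) ->
  (forall i g, i \in s -> J g -> c i * g * c i = - g) ->
  forall x, subalg_gen (c @` [set` s] `|` J) x -> w * x * w = x ->
  (forall v, subalg_gen K v -> star v * v = 1 -> v * star v = 1 ->
     cnorm (x0 - v * x * star v) <= eps) ->
  exists y, [/\ subalg_gen J y, w * y * w = y & cnorm (x0 - y) <= eps].
Proof.
move=> ww cstar cc canti wc wJ; elim=> [|i s IHs] /=.
  move=> _ _ _ x Jx wx dx; exists x; split=> //.
    apply: subalg_gen_sub Jx => g [[j /=]|Jg]; [by rewrite in_nil | exact: subalg_gen_in].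
  (* With nothing left to remove, the bound is used at [v = 1]. *)
  by have := dx 1; rewrite star1 !(mul1r, mulr1); apply=> //; exact: subalg_gen1.
case/andP=> is_ us Ks Js x Jx wx dx.
have anti g : (c @` [set` s] `|` J) g -> c i * g * c i = - g.
  case=> [[j /= js <-]|]; last by apply: Js; rewrite mem_head.
  by apply: canti; apply: contraNneq is_ => ->.
have antiw g : (c @` [set` s] `|` J) g -> w * g * w = - g.
  by case=> [[j /= js <-]|/wJ].
have Jx' : subalg_gen (c i |` (c @` [set` s] `|` J)) x.
  apply: subalg_gen_sub Jx => g Hg; apply: subalg_gen_in.
  case: Hg => [[j /=]|Jg]; last by right; right.
  by rewrite inE => /predU1P[-> <-|js <-]; [left|right; left; exists j].
have [Ey wy] := average_gen (cc i) ww (wc i) anti antiw Jx' wx.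
apply: (IHs us _ _ _ Ey wy) => [j js|j g js|v Kv vv vv'].
- by apply: Ks; rewrite inE js orbT.
- by apply: Js; rewrite inE js orbT.
have dv := dx v Kv vv vv'.
have := dx (v * c i); rewrite starM cstar.
have -> : v * c i * x * (c i * star v) = v * (c i * x * c i) * star v.
  by rewrite !mulrA.
have -> : c i * star v * (v * c i) = 1.
  by rewrite -mulrA (mulrA (star v)) vv mul1r.
have -> : v * c i * (c i * star v) = 1.
  by rewrite -mulrA (mulrA (c i)) cc mul1r.
move=> /(_ (subalg_genM Kv (Ks _ (mem_head _ _))) erefl erefl) dvi.
(* Splitting [x0] into two halves pairs one with each conjugate, and the triangle inequality
   averages the bounds [dv] and [dvi]. *)
rewrite -scalerAr -scalerAl -[x0]scale_halfD -scalerBr cnorm_half.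
rewrite mulrDr mulrDl opprD addrACA mulrC ler_pdivrMr ?ltr0n // mulr_natr mulr2n.
exact: le_trans (cnormD_le _ _) (lerD dv dvi).
Qed.

(** * Spectral form of a sum of commuting idempotents, and its exponential *)

(** A pair [(k, P)] of [l] is an eigenvalue with its coefficient. A further idempotent [e] splits it
    into [(k, P (1 - e))] and [(k + 1, P e)]; eigenvalues may repeat in the list. *)
Lemma idempotent_sum_spectral (K : comPzRingType) (A : algType K) (I : Type)
    (e : I -> A) (s : seq I) :
  (forall i, e i * e i = e i) -> (forall i j, e i * e j = e j * e i) ->
  exists l : seq (nat * A),
    (forall m, (\sum_(i <- s) e i) ^+ m = \sum_(p <- l) (p.1%:R : K) ^+ m *: p.2)
    /\ \prod_(i <- s) (1 - e i - e i) = \sum_(p <- l) (-1 : K) ^+ p.1 *: p.2.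
Proof.
move=> ee ec; elim: s => [|i s [l [lN lW]]].
  (* The empty sum has the single eigenvalue 0; the power [m = 0] relies on [0 ^+ 0 = 1]. *)
  exists [:: (0%N, 1)]; split=> [m|]; rewrite !big_nil big_seq1 /= ?expr0 ?scale1r //.
  by case: m => [|m]; rewrite ?expr0 ?scale1r // mulr0n !expr0n scale0r.
exists ([seq (p.1, p.2 * (1 - e i)) | p <- l] ++ [seq (p.1.+1, p.2 * e i) | p <- l]).
set N := \sum_(j <- s) e j in lN.
have eN : GRing.comm (e i) N by apply: commr_sum => j _; exact: ec.
split.
  move=> m; rewrite big_cons big_cat !big_map /=.
  have -> : \sum_(p <- l) (p.1%:R : K) ^+ m *: (p.2 * (1 - e i)) = N ^+ m * (1 - e i).
    by rewrite lN mulr_suml; apply: eq_bigr => p _; rewrite scalerAl.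
  (* The binomial formula reduces [(N + 1) ^+ m] to powers of [N]; summed eigenvalue by eigenvalue,
     the scalars recombine to [(k + 1) ^+ m]. *)
  have -> : \sum_(p <- l) (p.1.+1%:R : K) ^+ m *: (p.2 * e i) = (N + 1) ^+ m * e i.
    rewrite (addrC N) (exprDn_comm _ (commr_sym (commr1 N))).
    under [in RHS]eq_bigr => k _ do rewrite expr1n mul1r lN -sumrMnl.
    rewrite [in RHS]exchange_big mulr_suml; apply: eq_bigr => p _ /=.
    rewrite scalerAl; congr (_ * _).
    under [in RHS]eq_bigr => k _ do rewrite scalerMnl.
    rewrite -scaler_suml -(natr1 p.1) addrC exprDn; congr (_ *: _).
    by apply: eq_bigr => k _; rewrite expr1n mul1r.
  (* The new sum [e i + N] acts as [N] against [1 - e i] and as [N + 1] against [e i], so its powers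
     split in the same way. *)
  have h1 : (1 - e i) * (e i + N) = N * (1 - e i).
    by rewrite mulrDr mulrBl mul1r ee subrr add0r mulrBl mulrBr mul1r mulr1 eN.
  have h2 : e i * (e i + N) = (N + 1) * e i.
    by rewrite mulrDr ee eN addrC mulrDl mul1r.
  elim: m => [|m IHm]; first by rewrite !expr0 !mul1r subrK.
  by rewrite exprSr IHm mulrDl -!mulrA h1 h2 !mulrA -!exprSr.
rewrite big_cons big_cat !big_map /=.
set W := \prod_(j <- s) _ in lW *.
have eW : GRing.comm (e i) W.
  by apply: commr_prod => j _; apply: commrB; [apply: commrB; [exact: commr1|]|]; exact: ec.
have -> : \sum_(p <- l) (-1 : K) ^+ p.1 *: (p.2 * (1 - e i)) = W * (1 - e i).
  by rewrite lW mulr_suml; apply: eq_bigr => p _; rewrite scalerAl.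
have -> : \sum_(p <- l) (-1 : K) ^+ p.1.+1 *: (p.2 * e i) = - (W * e i).
  rewrite lW mulr_suml -sumrN; apply: eq_bigr => p _.
  by rewrite exprS mulN1r scaleNr scalerAl.
by rewrite !mulrBl mul1r eW mulrBr mulr1.
Qed.

(** Limits in norm are unique, so the choice made by [xget] is forced as soon as some limit is
    known. *)
Lemma cnorm_limitE (R : realType) (A : cstarAlgType R) (u : nat -> A) (l : A) :
  (fun n => cnorm (u n - l)) @ \oo --> (0 : R) -> cnorm_limit u = l.
Proof.
move=> ul; rewrite /cnorm_limit.
case: xgetP => [_ -> ul'|/(_ l)]; last by [].
set l' := xget _ _ in ul' *.
apply/eqP; rewrite -subr_eq0; apply/eqP/cnorm0_eq0/eqP.
rewrite eq_le cnorm_ge0 andbT.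
have := cvgD ul' ul; rewrite addr0 => /(_ _) s0.
rewrite -(cvg_lim (@norm_hausdorff _ _) s0); apply: limr_ge; first exact: cvgP s0.
near=> n => /=.
have -> : l' - l = - (u n - l') + (u n - l) by rewrite opprB addrA subrK.
by rewrite (le_trans (cnormD_le _ _)) // cnorm_opp.
Unshelve. all: by end_near. Qed.

Lemma normc_le (R : realType) (x y : R) :
  Normc.normc (x +i* y)%C <= `|x| + `|y|.
Proof.
rewrite /= -(ger0_norm (addr_ge0 (normr_ge0 x) (normr_ge0 y))) -sqrtr_sqr.
rewrite ler_wsqrtr // sqrrD !real_normK ?num_real // lerD2r lerDl.
by rewrite mulrn_wge0 // mulr_ge0.
Qed.

(** The signs and parity factors are laid out as in [cos_coeff] and [sin_coeff]. At [n = 0] the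
    truncated [n.-1] is harmless, its term being killed by [odd n]. *)
Lemma expr_imaginary (R : realType) (x : R) (n : nat) :
  ((0 +i* x)%C : R[i]) ^+ n =
  ((~~ odd n)%:R * (-1) ^+ n./2 * x ^+ n +i*
   ((odd n)%:R * (-1) ^+ n.-1./2 * x ^+ n))%C.
Proof.
elim: n => [|n IHn]; first by rewrite !expr0 /= !mulr1.
rewrite exprS {}IHn; apply/eqP; rewrite eq_complex /=; apply/andP; split; apply/eqP.
  rewrite mul0r sub0r negbK; case: n => [|n] /=; first by rewrite !mul0r mulr0 oppr0.
  case: (odd n) => /=; first by rewrite !mul0r mulr0 oppr0.
  by rewrite !mul1r [x ^+ n.+2]exprS [(-1) ^+ _.+1]exprS mulN1r mulNr mulrCA.
rewrite mul0r add0r; case: (odd n) => /=; first by rewrite !mul0r mulr0.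
by rewrite !mul1r mulrCA -exprS.
Qed.

Lemma expi_term (R : realType) (x : R) (n : nat) :
  (n`!%:R : R[i])^-1 * (0 +i* x)%C ^+ n = (cos_coeff x n +i* sin_coeff x n)%C.
Proof.
rewrite expr_imaginary /cos_coeff /sin_coeff /=.
have -> : (n`!%:R : R[i])^-1 = (n`!%:R^-1)%:C%C.
  by rewrite fmorphV rmorph_nat.
rewrite mulrC; apply/eqP; rewrite eq_complex /= !mulr0 subr0 add0r.
by rewrite !eqxx.
Qed.

Lemma sum_complex (R : realType) (f g : nat -> R) (n : nat) :
  \sum_(0 <= k < n) ((f k +i* g k)%C : R[i]) = (series f n +i* series g n)%C.
Proof.
elim: n => [|n IHn]; first by rewrite /series /= !big_geq.
by rewrite /series /= !big_nat_recr //= IHn.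
Qed.

(** The real and imaginary parts of the partial sums are those of the series of [cos] and [sin] at
    [k pi], whose values follow from the sign change of both functions under translation by [pi]. *)
Lemma expi_natpi_cvg (R : realType) (k : nat) :
  (fun n => Normc.normc (\sum_(0 <= j < n)
      (j`!%:R : R[i])^-1 * (0 +i* pi)%C ^+ j * k%:R ^+ j - (-1) ^+ k))
    @ \oo --> (0 : R).
Proof.
set x : R := pi *+ k.
have Cx : series (cos_coeff x) @ \oo --> ((-1) ^+ k : R).
  have <- : cos x = (-1) ^+ k.
    by have := alternatingn (@cosDpi R) k 0; rewrite add0r cos0 mulr1.
  rewrite cos.unlock.
  exact: is_cvg_series_cos_coeff.
have Sx : series (sin_coeff x) @ \oo --> (0 : R).
  have <- : sin x = 0.
    by have := alternatingn (@sinDpi R) k 0; rewrite add0r sin0 mulr0.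
  rewrite sin.unlock.
  exact: is_cvg_series_sin_coeff.
have E n : \sum_(0 <= j < n) (j`!%:R : R[i])^-1 * (0 +i* pi)%C ^+ j * k%:R ^+ j
    - (-1) ^+ k = ((series (cos_coeff x) n - (-1) ^+ k) +i* series (sin_coeff x) n)%C.
  have -> : ((-1) ^+ k : R[i]) = ((-1) ^+ k)%:C%C by rewrite rmorphXn rmorphN1.
  rewrite (eq_bigr (fun j => (cos_coeff x j +i* sin_coeff x j)%C)) => [|j _].
    rewrite sum_complex; apply/eqP.
    by rewrite eq_complex /= subr0 !eqxx.
  rewrite -expi_term -mulrA -exprMn; congr (_ * _ ^+ _).
  have <- : ((k%:R)%:C%C : R[i]) = k%:R by rewrite rmorph_nat.
  by apply/eqP; rewrite eq_complex /= !mul0r mulr0 subr0 add0r mulr_natr !eqxx.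
under eq_fun do rewrite E.
have C0 : (fun n => `|series (cos_coeff x) n - (-1) ^+ k| + `|series (sin_coeff x) n|)
    @ \oo --> (0 : R).
  rewrite -[0]addr0 -{1}(normr0 R) -{2}(normr0 R) -{1}(subrr ((-1) ^+ k)).
  by apply: cvgD; apply: cvg_norm => //; apply: cvgB => //; exact: cvg_cst.
apply: squeeze_cvgr (cvg_cst 0) C0; near=> n.
by rewrite normc_le andbT; exact: sqrtr_ge0.
Unshelve. all: by end_near. Qed.

(** The spectral form of the powers turns each partial sum of the exponential into a finite
    combination of the fixed [p.2] with scalar exponential sums [t p.1 n] as coefficients, so scalar
    convergence suffices. *)
Lemma expA_spectral (R : realType) (A : cstarAlgType R) (x : A)
    (l : seq (nat * A)) :
  (forall m, x ^+ m = \sum_(p <- l) (p.1%:R : R[i]) ^+ m *: p.2) ->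
  expA ((0 +i* pi)%C *: x) = \sum_(p <- l) (-1 : R[i]) ^+ p.1 *: p.2.
Proof.
move=> xl; apply: cnorm_limitE.
pose t k n : R[i] := \sum_(0 <= j < n) (j`!%:R : R[i])^-1 * (0 +i* pi)%C ^+ j * k%:R ^+ j.
have E n : \sum_(0 <= k < n) (k`!%:R : R[i])^-1 *: ((0 +i* pi)%C *: x) ^+ k
    = \sum_(p <- l) t p.1 n *: p.2.
  under [RHS]eq_bigr => p _ do rewrite scaler_suml.
  rewrite [RHS]exchange_big; apply: eq_bigr => j _ /=.
  rewrite exprZn xl !scaler_sumr; apply: eq_bigr => p _.
  by rewrite !scalerA.
under eq_fun do rewrite E.
elim: {xl E} l => [|p l IHl].
  by under eq_fun do rewrite !big_nil subrr cnorm_zero; exact: cvg_cst.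
have C0 : (fun n => Normc.normc (t p.1 n - (-1) ^+ p.1) * cnorm p.2 +
     cnorm (\sum_(q <- l) t q.1 n *: q.2 - \sum_(q <- l) (-1) ^+ q.1 *: q.2))
    @ \oo --> (0 : R).
  have := cvgD (cvgM (@expi_natpi_cvg R p.1) (cvg_cst (cnorm p.2))) IHl.
  by rewrite mul0r addr0; apply.
apply: squeeze_cvgr (cvg_cst 0) C0; near=> n.
rewrite cnorm_ge0 /= !big_cons opprD addrACA -scalerBl -cnormZ.
exact: cnormD_le.
Unshelve. all: by end_near. Qed.

(** * Products of commuting involutions *)

Lemma prod_involution (A : pzRingType) (I : Type) (s : I -> A) (t : seq I) :
  (forall i, s i * s i = 1) -> (forall i j, s i * s j = s j * s i) ->
  (\prod_(i <- t) s i) * (\prod_(i <- t) s i) = 1.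
Proof.
move=> ss sC; elim: t => [|i t IHt]; first by rewrite big_nil mulr1.
have siW : GRing.comm (s i) (\prod_(j <- t) s j) by apply: commr_prod => j _; exact: sC.
by rewrite big_cons {2}siW mulrA -(mulrA (s i)) IHt mulr1 ss.
Qed.

(** Commutativity reverses the right-hand product, so the conjugations nest; only the factor at [i]
    changes the sign, and it occurs at most once. *)
Lemma prod_involution_conj (A : pzRingType) (I : eqType) (s : I -> A) (b : A)
    (i : I) (t : seq I) :
  (forall j k, s j * s k = s k * s j) ->
  (forall j, s j * b * s j = if j == i then - b else b) -> uniq t ->
  (\prod_(j <- t) s j) * b * (\prod_(j <- t) s j) = if i \in t then - b else b.
Proof.
move=> sC sb; elim: t => [|j t IHt] /=; first by rewrite big_nil mulr1 mul1r.
case/andP=> jt ut.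
have sjW : GRing.comm (s j) (\prod_(k <- t) s k) by apply: commr_prod => k _; exact: sC.
rewrite big_cons {2}sjW !mulrA -(mulrA (s j)) -(mulrA (s j)) IHt // inE eq_sym.
case: eqVneq jt => [-> /negbTE ->|ji _]; first by rewrite sb eqxx.
by case: (i \in t); rewrite ?mulrN ?mulNr sb (negbTE ji).
Qed.

(** * Anticommutation relations and the parity *)

Lemma anticommutatorC (R : realType) (A : cstarAlgType R) (u v : A) :
  anticommutator u v = anticommutator v u.
Proof. exact: addrC. Qed.

Lemma anticommutatorZDl (R : realType) (A : cstarAlgType R) (z t : R[i])
    (u v w : A) :
  anticommutator (z *: u + t *: v) w =
  z *: anticommutator u w + t *: anticommutator v w.
Proof.
rewrite /anticommutator mulrDl mulrDr -!scalerAl -!scalerAr !scalerDr.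
exact: addrACA.
Qed.

Section CarParity.
Context {R : realType} {A : cstarAlgType R}.
Context {Gamma : countType} {Lambda : {fset Gamma}} (a : Lambda -> A).
Hypothesis hCAR : is_CAR_algebra a.

Let num x := star (a x) * a x.
Let sgn x := 1 - num x - num x.

Lemma car_aaC x y : a x * a y = - (a y * a x).
Proof. by apply/eqP; rewrite -addr_eq0; apply/eqP; exact: (car_aa hCAR). Qed.

Lemma car_ccC x y : star (a x) * star (a y) = - (star (a y) * star (a x)).
Proof. by apply/eqP; rewrite -addr_eq0; apply/eqP; exact: (car_cc hCAR). Qed.

Lemma car_acC x y : a x * star (a y) = (x == y)%:R - star (a y) * a x.
Proof. by rewrite -(car_ac hCAR) addrK. Qed.

Lemma car_sq x : a x * a x = 0.
Proof. by rewrite -[LHS]scale_halfD {1}car_aaC addNr scaler0. Qed.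

Lemma car_star_sq x : star (a x) * star (a x) = 0.
Proof. by rewrite -[LHS]scale_halfD {1}car_ccC addNr scaler0. Qed.

Lemma num_aC x y : num x * a y = a y * num x - (x == y)%:R * a x.
Proof.
rewrite /num -mulrA car_aaC mulrN !mulrA car_acC mulrBl eq_sym.
by rewrite addrAC subrr sub0r.
Qed.

Lemma num_starC x y : num x * star (a y) = star (a y) * num x + (x == y)%:R * star (a x).
Proof.
rewrite /num -mulrA car_acC mulrBr !mulrA car_ccC mulNr [LHS]addrC.
by case: eqP => _; rewrite ?mulr1 ?mul1r ?mulr0 ?mul0r.
Qed.

Lemma num_idem x : num x * num x = num x.
Proof.
rewrite {2}/num mulrA num_starC eqxx mul1r mulrDl /num -!mulrA car_sq !mulr0.
by rewrite add0r.
Qed.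

Lemma num_comm x y : num x * num y = num y * num x.
Proof.
case: (eqVneq x y) => [->//|xy].
rewrite {2}/num mulrA num_starC (negbTE xy) mul0r addr0 -mulrA num_aC (negbTE xy).
by rewrite mul0r subr0 mulrA.
Qed.

Lemma sgn_num x : sgn x * num x = - num x.
Proof. by rewrite /sgn !mulrBl mul1r num_idem subrr sub0r. Qed.

Lemma sgn_sq x : sgn x * sgn x = 1.
Proof.
by rewrite {2}/sgn !mulrBr mulr1 sgn_num opprK /sgn subrK subrK.
Qed.

Lemma sgn_comm x y : sgn x * sgn y = sgn y * sgn x.
Proof.
have c1 : GRing.comm (sgn x) (num y).
  apply: commr_sym; apply: commrB; [apply: commrB; [exact: commr1|]|];
  exact: num_comm.
by apply: commrB; [apply: commrB; [exact: commr1|]|].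
Qed.

(** At [x = y], [a y] lowers the occupation from 1 to 0: [num y * a y = 0] and [a y * num y = a y],
    so [sgn y] acts as 1 on its left and as -1 on its right. At distinct sites the two commute. *)
Lemma sgn_conj_a x y : sgn x * a y * sgn x = if x == y then - a y else a y.
Proof.
case: (eqVneq x y) => [->|xy].
  have ay : num y * a y = 0 by rewrite /num -mulrA car_sq mulr0.
  have ya : a y * num y = a y.
    by move: (num_aC y y); rewrite ay eqxx mul1r => /esym/eqP; rewrite subr_eq0 => /eqP.
  have -> : sgn y * a y = a y by rewrite /sgn !mulrBl mul1r ay !subr0.
  by rewrite /sgn !mulrBr mulr1 ya subrr sub0r.
have ay : num x * a y = a y * num x by rewrite num_aC (negbTE xy) mul0r subr0.
have -> : sgn x * a y = a y * sgn x by rewrite /sgn !mulrBl !mulrBr mul1r mulr1 ay.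
by rewrite -mulrA sgn_sq mulr1.
Qed.

Lemma sgn_conj_star x y :
  sgn x * star (a y) * sgn x = if x == y then - star (a y) else star (a y).
Proof.
case: (eqVneq x y) => [->|xy].
  have ya : star (a y) * num y = 0 by rewrite /num mulrA car_star_sq mul0r.
  have ay : num y * star (a y) = star (a y) by rewrite num_starC ya eqxx mul1r add0r.
  have -> : sgn y * star (a y) = - star (a y).
    by rewrite /sgn !mulrBl mul1r ay subrr sub0r.
  by rewrite /sgn !mulrBr mulr1 mulNr ya oppr0 !subr0.
have ay : num x * star (a y) = star (a y) * num x.
  by rewrite num_starC (negbTE xy) mul0r addr0.
have -> : sgn x * star (a y) = star (a y) * sgn x.
  by rewrite /sgn !mulrBl !mulrBr mul1r mulr1 ay.
by rewrite -mulrA sgn_sq mulr1.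
Qed.

Lemma parity_opE (X : {fset Gamma}) :
  parity_op a X = \prod_(x <- [seq x <- index_enum Lambda | val x \in X]) sgn x.
Proof.
have [l [lN ->]] := @idempotent_sum_spectral R[i] A _ num
  [seq x <- index_enum Lambda | val x \in X] num_idem num_comm.
by apply: expA_spectral => m; rewrite -lN big_filter.
Qed.

Lemma parity_op_sq (X : {fset Gamma}) : parity_op a X * parity_op a X = 1.
Proof. by rewrite parity_opE prod_involution //; [exact: sgn_sq|exact: sgn_comm]. Qed.

Lemma parity_op_conj_a (X : {fset Gamma}) y :
  parity_op a X * a y * parity_op a X = if val y \in X then - a y else a y.
Proof.
rewrite parity_opE (@prod_involution_conj _ _ _ _ y) ?filter_uniq ?index_enum_uniq //.
- by rewrite mem_filter mem_index_enum andbT.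
- exact: sgn_comm.
- by move=> j; exact: sgn_conj_a.
Qed.

Lemma parity_op_conj_star (X : {fset Gamma}) y :
  parity_op a X * star (a y) * parity_op a X =
  if val y \in X then - star (a y) else star (a y).
Proof.
rewrite parity_opE (@prod_involution_conj _ _ _ _ y) ?filter_uniq ?index_enum_uniq //.
- by rewrite mem_filter mem_index_enum andbT.
- exact: sgn_comm.
- by move=> j; exact: sgn_conj_star.
Qed.

(** * Majorana operators *)

Let al (b : bool) : R[i] := if b then 'i%C else 1.
Let be (b : bool) : R[i] := if b then - 'i%C else 1.

Definition majorana (p : Lambda * bool) : A :=
  al p.2 *: a p.1 + be p.2 *: star (a p.1).

Lemma majorana_star p : star (majorana p) = majorana p.
Proof.
rewrite /majorana starD !starZ starK addrC /al /be; case: p.2; last by rewrite rmorph1.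
by congr (_ *: _ + _ *: _); apply/eqP; rewrite eq_complex /= ?oppr0 ?opprK !eqxx.
Qed.

Lemma majorana_anticommutator p q :
  anticommutator (majorana p) (majorana q) = (p == q)%:R + (p == q)%:R.
Proof.
case: p q => [x b] [y d]; rewrite /majorana /=.
rewrite anticommutatorZDl ![anticommutator _ (_ + _)]anticommutatorC !anticommutatorZDl.
rewrite (car_aa hCAR) (car_cc hCAR) (car_ac hCAR) anticommutatorC (car_ac hCAR).
rewrite !scaler0 add0r addr0 !scalerA [y == x]eq_sym -scalerDl xpair_eqE.
have ii : 'i%C * 'i%C = -1 :> R[i] by rewrite -expr2 sqr_i.
case: eqP => _; last by rewrite scaler0 addr0.
(* At equal sites the scalar left is [al b * be d + be b * al d], which is 2 for [b = d] and 0
   otherwise. *)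
rewrite /al /be; case: b d => [] []; rewrite /= ?mulNr ?mulrN ?ii ?opprK ?mul1r ?mulr1.
- by rewrite scalerDl scale1r.
- by rewrite subrr scale0r addr0.
- by rewrite addNr scale0r addr0.
- by rewrite scalerDl scale1r.
Qed.

Lemma majorana_sq p : majorana p * majorana p = 1.
Proof.
have := majorana_anticommutator p p; rewrite eqxx /anticommutator => E.
by rewrite -[LHS]scale_halfD E scale_halfD.
Qed.

Lemma majorana_conj p q : p != q -> majorana p * majorana q * majorana p = - majorana q.
Proof.
move=> pq; have := majorana_anticommutator p q.
rewrite (negbTE pq) addr0 => /eqP; rewrite addr_eq0 => /eqP ->.
by rewrite mulNr -mulrA majorana_sq mulr1.
Qed.

Lemma parity_op_conj_majorana (X : {fset Gamma}) p : val p.1 \in X ->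
  parity_op a X * majorana p * parity_op a X = - majorana p.
Proof.
move=> pX; rewrite mulrDr mulrDl -!scalerAr -!scalerAl.
by rewrite parity_op_conj_a parity_op_conj_star pX !scalerN opprD.
Qed.

Lemma local_alg_majorana (X : {fset Gamma}) p : val p.1 \in X ->
  local_alg a X (majorana p).
Proof.
move=> pX; apply: subalg_genL; last apply: subalg_genZ.
  by apply: subalg_gen_in; exists p.1 => //; left.
by apply: subalg_gen_in; exists p.1 => //; right.
Qed.

(** With [c0], [c1] the two Majorana operators of a site, its generators are [(c0 - i c1) / 2] and
    [(c0 + i c1) / 2]. *)
Lemma local_algE (X : {fset Gamma}) :
  local_alg a X `<=` subalg_gen (majorana @` [set p | val p.1 \in X]).
Proof.
apply: subalg_gen_sub => y [x xX yE].
have M b : subalg_gen (majorana @` [set p | val p.1 \in X]) (majorana (x, b)).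
  by apply: subalg_gen_in; exists (x, b).
have E0 : a x + star (a x) = majorana (x, false) by rewrite /majorana /= !scale1r.
have E1 : a x - star (a x) = - 'i%C *: majorana (x, true).
  rewrite /majorana /= scalerDr !scalerA !mulNr mulrN opprK -expr2 sqr_i.
  by rewrite opprK scale1r scaleN1r.
case: yE => ->.
  rewrite -[a x]scale_halfD.
  have -> : a x + a x = - 'i%C *: majorana (x, true) + majorana (x, false).
    by rewrite -E1 -E0 addrACA addNr addr0.
  by apply: subalg_genZ; apply: subalg_genL.
rewrite -[star _]scale_halfD.
have -> : star (a x) + star (a x) = 'i%C *: majorana (x, true) + majorana (x, false).
  by rewrite -[_ *: _]opprK -scaleNr -E1 -E0 opprB addrA subrK.
by apply: subalg_genZ; apply: subalg_genL.
Qed.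

End CarParity.

Theorem lemma4p3 (R : realType) (Gamma : countType) (Lambda : {fset Gamma})
    (CAR : cstarAlgType R) (a : Lambda -> CAR) (hCAR : is_CAR_algebra a)
    (A : CAR) (hA : even_local_alg a Lambda A)
    (X : {fset Gamma}) (hX : (X `<=` Lambda)%fset)
    (eps : R) (heps : 0 < eps)
    (hcomm : forall B : CAR, local_alg a (Lambda `\` X)%fset B ->
       cnorm (commutator A B) <= eps * cnorm B) :
  exists A' : CAR, even_local_alg a X A' /\ cnorm (A - A') <= eps.
Proof.
have [LA wA] := hA.
(* [J] holds the Majorana operators to keep, [s] indexes those to average out. *)
pose J : set CAR := majorana a @` [set p | val p.1 \in X].
pose s := [seq p <- enum {: Lambda * bool} | val p.1 \notin X].
have wJ g : J g -> parity_op a Lambda * g * parity_op a Lambda = - g.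
  by case=> p _ <-; apply: parity_op_conj_majorana => //; exact: valP.
have [B [JB wB dB]] : exists B, [/\ subalg_gen J B,
    parity_op a Lambda * B * parity_op a Lambda = B & cnorm (A - B) <= eps].
  apply: (@average_out R CAR _ (majorana a) (parity_op a Lambda) A eps
    [set b | exists2 x : Lambda, val x \in (Lambda `\` X)%fset &
                                 b = a x \/ b = star (a x)]
    J (parity_op_sq hCAR _) (majorana_star _) (majorana_sq hCAR)
    (majorana_conj hCAR) _ wJ s _ _ _ A _ wA).
  - by move=> p; apply: parity_op_conj_majorana => //; exact: valP.
  - by rewrite filter_uniq // enum_uniq.
  - move=> p; rewrite mem_filter => /andP[pX _]; apply: local_alg_majorana.
    by rewrite in_fsetD pX; exact: valP.
  - move=> p _ ps [q /= qX <-]; apply: majorana_conj => //.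
    by apply: contraTneq ps => ->; rewrite mem_filter qX.
  - apply: subalg_gen_sub (local_algE LA) => _ [p _ <-]; apply: subalg_gen_in.
    case: (boolP (val p.1 \in X)) => pX; [right|left]; exists p => //=.
    by rewrite mem_filter pX mem_enum.
  (* For a unitary [v] of the algebra of the complement, [A - v A v*] is [[A, v] v*], and both [v]
     and [v*] have norm 1, so [hcomm] bounds it by [eps]. *)
  - move=> v Kv vv vv'.
    have -> : A - v * A * star v = commutator A v * star v.
      by rewrite mulrBl -[A * v * _]mulrA vv' mulr1.
    have nv : cnorm v = 1 by exact: cnorm_isometry.
    have nv' : cnorm (star v) = 1 by apply: cnorm_isometry; rewrite starK.
    by rewrite (le_trans (cnormM_le _ _)) // nv' mulr1 (le_trans (hcomm v Kv)) // nv mulr1.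
exists B; split=> //; split.
  by apply: subalg_gen_sub JB => _ [p pX <-]; exact: local_alg_majorana.
(* [B] is known to be even for the parity of [Lambda]. Both parities negate every element of [J], so
   they act alike on the algebra containing [B]. *)
rewrite -[RHS]wB; apply: (eq_conj_gen _ _ _ JB); try exact: parity_op_sq.
move=> _ [p pX <-]; rewrite !parity_op_conj_majorana //; exact: valP.
Qed.
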